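(* Let $(A,\mathbf{B})$ be a homogeneous monotonic P-polynomial table algebra with $\mathbf{B}=\{x_0=1_A,x_1,\dots,x_d\}$ and $d\ge 5$. Then the eigenvalues of the first intersection matrix of $(A,\mathbf{B})$ are given by $$\lambda_i=\frac{k+2}{2}\cos(\theta_i)+\frac{k-2}{2},\qquad 0\le i\le d,$$ where $k$ is the valency of $(A,\mathbf{B})$ and the $\theta_i$ are the roots of the following equation: $$(k+2)\sin((d+2)\theta)-4\sin((d+1)\theta)-2k\sin(d\theta)+4\sin((d-1)\theta)+(k-2)\sin((d-2)\theta)=0.$$
   Context: Table algebra: let $A$ be a finite-dimensional associative commutative algebra over $\mathbb{C}$ with a basis $\mathbf{B}=\{x_0=1_A,x_1,\dots,x_d\}$. The pair $(A,\mathbf{B})$ is a table algebra if: (i) $x_ix_j=\sum_{m=0}^d\beta_{ijm}x_m$ with all $\beta_{ijm}$ nonnegative real numbers; (ii) there is an algebra automorphism $\overline{\phantom{x}}$ of $A$ whose order divides 2 such that $x_i\in\mathbf{B}$ implies $\overline{x_i}\in\mathbf{B}$, and $\overline{i}$ is defined by $x_{\overline{i}}=\overline{x_i}$; (iii) for all $i,j$, $\beta_{ij0}\ne 0$ if and only if $j=\overline{i}$, and $\beta_{i\overline{i}0}>0$. $(A,\mathbf{B})$ is real if $i=\overline{i}$ for all $0\le i\le d$. There is a unique algebra homomorphism $f:A\to\mathbb{C}$ with $f(x_i)=f(x_{\overline{i}})\in\mathbb{R}^+$ (positive reals) for all $0\le i\le d$. $(A,\mathbf{B})$ is standard if $f(x_i)=\beta_{i\overline{i}0}$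 for all $i$. It is homogeneous if $d\ge 2$ and $f(x_i)$ is constant for $i>0$. The first intersection matrix is the $(d+1)\times(d+1)$ matrix $B_1=(\beta_{1jm})_{0\le j,m\le d}$ (row index $j$, column index $m$). A real standard table algebra is P-polynomial if for each $2\le i\le d$ there is a polynomial $\nu_i(x)$ with complex coefficients, of degree $i$, such that $x_i=\nu_i(x_1)$. In that case, for all $i$ there are real numbers $b_{i-1},a_i,c_{i+1}$ with $x_1x_i=b_{i-1}x_{i-1}+a_ix_i+c_{i+1}x_{i+1}$, where $b_i\ne 0$ ($0\le i\le d-1$), $c_i\ne 0$ ($1\le i\le d$), and $b_{-1}=c_{d+1}=0$. The number $b_0=\beta_{110}$ is called the valency. A P-polynomial table algebra is monotonic if $c_i\le c_{i+1}$ for $1\le i\le d-1$ and $b_i\ge b_{i+1}$ for $0\le i\le d-2$.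
   Formalization: The roots θ_i are taken to be the real roots in [0, π), which are exactly d+1 distinct numbers: θ = π always solves the equation but would give λ = -2, which is not an eigenvalue (e.g. for the 11-gon, d = 5, k = 2). *)

(* Defs.v *)
From HB Require Import structures.
From mathcomp Require Import all_boot all_order all_algebra all_field.
From mathcomp Require Import complex.
From mathcomp Require Import reals trigo.

Set Implicit Arguments.
Unset Strict Implicit.
Unset Printing Implicit Defensive.

Import Order.TTheory GRing.Theory Num.Theory.
Local Open Scope ring_scope.
Local Open Scope complex_scope.

(* [structure_const x i j m] is beta_{ijm}, the coefficient of x_m in x_i x_j. *)
Definition structure_const (R : realType) (d : nat) (A : falgType R[i])
    (x : d.+1.-tuple A) (i j m : 'I_d.+1) : R[i] :=
  coord x m (tnth x i * tnth x j).

(* In R[i], [0 <= z] (resp. [0 < z]) means that z is a nonnegative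
   (resp. positive) real number. *)
Record tableAlgebra (R : realType) (d : nat) := TableAlgebra {
  ta_alg : falgType R[i];
  ta_mulC : forall u v : ta_alg, u * v = v * u;
  ta_basis : d.+1.-tuple ta_alg;
  ta_basisP : basis_of fullv ta_basis;
  ta_basis0 : tnth ta_basis ord0 = 1;
  ta_const_ge0 : forall i j m, 0 <= structure_const ta_basis i j m;
  ta_bar : {lrmorphism ta_alg -> ta_alg};
  ta_barK : involutive ta_bar;
  ta_conj : 'I_d.+1 -> 'I_d.+1;
  ta_barE : forall i, ta_bar (tnth ta_basis i) = tnth ta_basis (ta_conj i);
  ta_const0_neq0 : forall i j,
    structure_const ta_basis i j ord0 != 0 <-> j = ta_conj i;
  ta_const0_gt0 : forall i, 0 < structure_const ta_basis i (ta_conj i) ord0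
}.

Section TableAlgebraTheory.
Variables (R : realType) (d : nat) (T : tableAlgebra R d).

Definition ta_elt (i : 'I_d.+1) : ta_alg T := tnth (ta_basis T) i.

Definition ta_beta (i j m : 'I_d.+1) : R[i] :=
  structure_const (ta_basis T) i j m.

Definition real_ta : Prop := forall i, ta_conj T i = i.

(* Every table algebra has exactly one such homomorphism. *)
Definition is_degree_map (f : {lrmorphism ta_alg T -> R[i]^o}) : Prop :=
  forall i, f (ta_elt i) = f (ta_elt (ta_conj T i)) /\
            0 < (f (ta_elt i) : R[i]).

Definition standard_ta (f : {lrmorphism ta_alg T -> R[i]^o}) : Prop :=
  forall i, f (ta_elt i) = ta_beta i (ta_conj T i) ord0.

Definition homogeneous_ta (f : {lrmorphism ta_alg T -> R[i]^o}) : Prop :=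
  (2 <= d)%N /\
  forall i j, i != ord0 -> j != ord0 -> f (ta_elt i) = f (ta_elt j).

(* [inord 1] is the index 1 as soon as d >= 1. *)
Definition first_intersection_matrix : 'M[R[i]]_d.+1 :=
  \matrix_(j, m) ta_beta (inord 1) j m.

Definition P_polynomial_ta (f : {lrmorphism ta_alg T -> R[i]^o}) : Prop :=
  [/\ real_ta, standard_ta f &
      forall i : 'I_d.+1, (2 <= i)%N ->
        exists nu : {poly R[i]},
          size nu = i.+1 /\ ta_elt i = horner_alg (ta_elt (inord 1)) nu].

(* As x_1 x_i = b_{i-1} x_{i-1} + a_i x_i + c_{i+1} x_{i+1}, the number b_i
   (0 <= i <= d-1) is the coefficient of x_i in x_1 x_{i+1}, and c_i
   (1 <= i <= d) is the coefficient of x_i in x_1 x_{i-1}. *)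
Definition ta_b (i : nat) : R[i] := ta_beta (inord 1) (inord i.+1) (inord i).
Definition ta_c (i : nat) : R[i] := ta_beta (inord 1) (inord i.-1) (inord i).

Definition monotonic_ta : Prop :=
  (forall i, (1 <= i)%N -> (i.+1 <= d)%N -> ta_c i <= ta_c i.+1) /\
  (forall i, (i.+2 <= d)%N -> ta_b i.+1 <= ta_b i).

(* b_0 = beta_{110} is a nonnegative real number, so taking the real part only
   changes its type. *)
Definition valency : R := complex.Re (ta_b 0).

End TableAlgebraTheory.

Definition theta_equation (R : realType) (d : nat) (k t : R) : Prop :=
  (k + 2) * sin ((d%:R + 2) * t) - 4 * sin ((d%:R + 1) * t)
  - 2 * k * sin (d%:R * t) + 4 * sin ((d%:R - 1) * t)
  + (k - 2) * sin ((d%:R - 2) * t) = 0.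

Definition lambda_of (R : realType) (k t : R) : R :=
  (k + 2) / 2 * cos t + (k - 2) / 2.

(* Main.v *)
Require Import Defs.
From HB Require Import structures.
From mathcomp Require Import all_boot all_order all_algebra all_field.
From mathcomp Require Import complex.
From mathcomp Require Import topology normedtype realfun.
From mathcomp Require Import reals trigo.
From mathcomp Require Import ring lra zify.

(** The theorem splits into a rigidity statement for the algebra and an
    eigenvector computation for one explicit tridiagonal matrix.

    Rigidity.  Write k for the valency.  The form beta_{ijm} beta_{mm0} is
    symmetric in i, j, m, and homogeneity gives beta_{mm0} = k for all m >= 1;
    hence b_i = c_{i+1} for i >= 1.  The c_i increase and the b_i decrease, so
    c_2 = ... = c_d; call this number c.  Applying the degree map to x_1 x_i
    then expresses the diagonal of the first intersection matrix in k and c.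
    Computing with x_1 x_1, x_1 x_2, x_1 x_3 and x_1 x_4 one finds
      beta_{222} = 4c - 2 - k   and   beta_{333} = k + 2 - 4c;
    both are nonnegative, so c = (k+2)/4.  The second computation requires that
    x_4 be an interior element, whence d >= 5.  Thus k determines the matrix
    ([first_intersection_matrixE]).

    Eigenvectors.  Away from its first rows the matrix is a Toeplitz matrix with
    c on both off-diagonals and k - 2c on the diagonal, and a reflecting
    boundary at d, so with lambda = 2c cos t + (k - 2c) the vector with entries
    cos((d + 1/2 - j) t) for j >= 1, and a suitable entry at 0, satisfies all
    the equations of a left eigenvector but the one in column 0.  The defect in
    that equation is a multiple of sin(t/2) G(t), where
      G(t) = k sin(dt) cos(t/2) + 2 cos(dt) sin(t/2),
    and the left-hand side of the equation for theta equals
    - 8 sin(t) sin(t/2) G(t).  So every root in [0, pi) gives an eigenvalue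
    ([tri_eigenvalue]).

    Counting.  Since
      G(t) = (k+2)/2 sin((d+1/2) t) + (k-2)/2 sin((d-1/2) t)
    and |k-2| < k+2, the sign of G alternates along the d+1 points where
    sin((d+1/2) t) = 1 or -1, the last of which is pi.  This gives d roots in
    (0, pi), and 0 is one more ([theta_roots]).  Since cos is injective on
    [0, pi], the d+1 roots give d+1 distinct eigenvalues.  A matrix of size d+1
    has no others, and consequently the equation has no other roots in [0, pi). *)

Set Implicit Arguments.
Unset Strict Implicit.
Unset Printing Implicit Defensive.

Import Order.TTheory GRing.Theory Num.Theory.
Import numFieldNormedType.Exports.
Local Open Scope ring_scope.
Local Open Scope complex_scope.

(** * The equation for theta *)

Lemma sin_half (R : realType) (t : R) : sin t = 2 * sin (t / 2) * cos (t / 2).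
Proof.
have {1}-> : t = t / 2 + t / 2 by field.
by rewrite sinD; ring.
Qed.

Lemma cos_half (R : realType) (t : R) : cos t = 1 - 2 * sin (t / 2) ^+ 2.
Proof.
have {1}-> : t = t / 2 + t / 2 by field.
by rewrite cosD; have := cos2Dsin2 (t / 2); lra.
Qed.

Section ThetaEquation.
Variables (R : realType) (d : nat) (k : R).

Definition theta_core (t : R) : R :=
  k * sin (d%:R * t) * cos (t / 2) + 2 * cos (d%:R * t) * sin (t / 2).

(** Pairing the terms at d + 2 with d - 2 and at d + 1 with d - 1, the left-hand
    side becomes - 4 sin t (k sin(dt) sin t + 2 cos(dt) (1 - cos t)); the
    half-angle formulas take a further factor 2 sin(t/2) out of the bracket. *)
Lemma theta_equation_factor t :
  theta_equation d k t <-> sin t * (sin (t / 2) * theta_core t) = 0.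
Proof.
have D2 : (d%:R + 2) * t = d%:R * t + (t + t) by ring.
have D1 : (d%:R + 1) * t = d%:R * t + t by ring.
have B1 : (d%:R - 1) * t = d%:R * t + (- t) by ring.
have B2 : (d%:R - 2) * t = d%:R * t + (- t + - t) by ring.
rewrite /theta_equation D2 D1 B1 B2 /theta_core !(sinD, cosD) !sinN !cosN.
set S := sin (d%:R * t); set C := cos (d%:R * t).
set E := (X in X = 0 <-> _).
have -> : E = - 8 * (sin t *
    (sin (t / 2) * (k * S * cos (t / 2) + 2 * C * sin (t / 2)))).
  have -> : sin t * (sin (t / 2) * (k * S * cos (t / 2) + 2 * C * sin (t / 2))) =
    sin t * (k * S * sin t + 2 * C * (1 - cos t)) / 2.
    by rewrite (sin_half t) (cos_half t); field.
  have c2 : cos t * cos t = 1 - sin t * sin t by have := cos2Dsin2 t; lra.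
  by rewrite /E c2; field.
split=> [|->]; last by rewrite mulr0.
by move/eqP; rewrite mulf_eq0 oppr_eq0 pnatr_eq0 /= => /eqP.
Qed.

Lemma theta_core_sum t : theta_core t =
  (k + 2) / 2 * sin ((d%:R + 2^-1) * t) + (k - 2) / 2 * sin ((d%:R - 2^-1) * t).
Proof.
have -> : (d%:R + 2^-1) * t = d%:R * t + t / 2 by ring.
have -> : (d%:R - 2^-1) * t = d%:R * t + - (t / 2) by ring.
by rewrite !sinD sinN cosN /theta_core; field.
Qed.

(** For i >= 1 these are the positive solutions of |sin((d + 1/2) t)| = 1; the
    index 0 is allowed so that the root 0 also lies between two of them. *)
Definition extremal_pt (i : nat) : R := (2 * i%:R - 1) / (2 * d%:R + 1) * pi.

Lemma theta_core_sign i : 0 < k -> 0 < (-1) ^+ i * theta_core (extremal_pt i.+1).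
Proof.
move=> k0; rewrite theta_core_sum.
have d0 : (0:R) <= d%:R by [].
have -> : (d%:R + 2^-1) * extremal_pt i.+1 = pi *+ i + pi / 2.
  by rewrite /extremal_pt -mulr_natr -natr1; field; lra.
have -> : sin (pi *+ i + pi / 2) = (-1) ^+ i :> R.
  rewrite sinDpihalf; elim: i => [|i IH]; first by rewrite mulr0n cos0.
  by rewrite mulrSr cosDpi IH exprS mulN1r.
set X := (d%:R - _) * _.
rewrite mulrDr mulrCA -expr2 sqrr_sign mulr1.
(* what is left is (k+2)/2 plus or minus (k-2)/2 times a number in [-1, 1] *)
have := sin_le1 X; have := sin_geN1 X; set s := sin X => h1 h2.
by case: (boolP (odd i)) => oi;
  rewrite -signr_odd ?oi ?(negbTE oi) ?expr1 ?expr0; nra.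
Qed.

Lemma theta_core_continuous : continuous theta_core.
Proof.
have cl (a : R) : continuous (fun t : R => a * t) by exact: mulrl_continuous.
have h : continuous (fun t : R => t / 2) by exact: mulrr_continuous.
have cs (g : R -> R) : continuous g -> continuous (fun t => sin (g t)).
  move=> cg t; exact: (continuous_comp (cg t) (@continuous_sin R (g t))).
have cc (g : R -> R) : continuous g -> continuous (fun t => cos (g t)).
  move=> cg t; exact: (continuous_comp (cg t) (@continuous_cos R (g t))).
have c1 := cs _ (cl d%:R); have c2 := cc _ h.
have c3 := cc _ (cl d%:R); have c4 := cs _ h.
move=> t; apply: cvgD; apply: cvgM.
- by apply: cvgM; [exact: cvg_cst|exact: c1].
- exact: c2.
- by apply: cvgM; [exact: cvg_cst|exact: c3].
- exact: c4.
Qed.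

Lemma le_extremal_pt i j : (i <= j)%N -> extremal_pt i <= extremal_pt j.
Proof.
move=> ij; have d0 : (0:R) <= d%:R by [].
have ij' : i%:R <= j%:R :> R by rewrite ler_nat.
by rewrite /extremal_pt ler_pM2r ?pi_gt0 // ler_pM2r ?invr_gt0; lra.
Qed.

Lemma extremal_pt_last : extremal_pt d.+1 = pi.
Proof.
have d0 : (0:R) <= d%:R by [].
by rewrite /extremal_pt -natr1 -[RHS]mul1r; congr (_ * _); field; lra.
Qed.

Lemma extremal_pt_around0 : extremal_pt 0 < 0 < extremal_pt 1.
Proof.
have d0 : (0:R) <= d%:R by []; have p := pi_gt0 R.
have u : 0 < (2 * d%:R + 1)^-1 * pi :> R by rewrite mulr_gt0 // invr_gt0; lra.
by rewrite /extremal_pt -!mulrA; apply/andP; split; nra.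
Qed.

(** One root lies in each of the d+1 half-open intervals cut out by the
    extremal points: 0 in the first one, and by the intermediate value theorem
    a zero of [theta_core] in every other one. *)
Lemma theta_roots : 0 < k ->
  exists theta : 'I_d.+1 -> R, injective theta /\
    forall i, 0 <= theta i < pi /\ theta_equation d k (theta i).
Proof.
move=> k0.
have root_between (i : 'I_d.+1) : exists t,
    extremal_pt i <= t < extremal_pt i.+1 /\ (0 <= t /\ theta_equation d k t).
  case: i => -[|i] /= ltid.
    have /andP[a b] := extremal_pt_around0.
    by exists 0; rewrite (ltW a) b lexx theta_equation_factor sin0 mul0r.
  have s1 := theta_core_sign i k0; have s2 := theta_core_sign i.+1 k0.
  have [||t] := @IVT _ theta_core (extremal_pt i.+1) (extremal_pt i.+2) 0
      (le_extremal_pt (leqnSn _)).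
  - by apply: continuous_subspaceT => x; exact: theta_core_continuous.
  - rewrite ge_min le_max.
    move: s1 s2; rewrite exprS mulN1r mulNr oppr_gt0 -signr_odd.
    case: (odd i); rewrite ?expr1 ?expr0 ?mulN1r ?mul1r ?oppr_gt0 ?oppr_lt0;
      by move=> /ltW -> /ltW ->; rewrite ?orbT.
  rewrite in_itv /= => /andP[t1 t2] e.
  exists t; rewrite t1 lt_neqAle t2 andbT; split; last split.
  - by apply/eqP => tt; move: s2; rewrite -tt e mulr0 ltxx.
  - have /andP[_ b] := extremal_pt_around0.
    exact: le_trans (ltW b) (le_trans (le_extremal_pt (isT : (0 < i.+1)%N)) t1).
  - by rewrite theta_equation_factor e !mulr0.
have [theta th] := fin_all_exists root_between; exists theta; split; last first.
  move=> i; have [/andP[_ b] [c e]] := th i; split=> //; rewrite c /=.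
  by apply: lt_le_trans b _; rewrite -extremal_pt_last le_extremal_pt.
suff lt_theta (i j : 'I_d.+1) : (i < j)%N -> theta i < theta j.
  move=> i j e; apply: val_inj.
  by case: (ltngtP i j) => // /lt_theta; rewrite e ltxx.
move=> ij; have [/andP[_ b] _] := th i; have [/andP[c _] _] := th j.
exact: lt_le_trans b (le_trans (le_extremal_pt ij) c).
Qed.

End ThetaEquation.

(** * The tridiagonal matrix and its eigenvectors *)

Lemma sum_band (V : zmodType) (n : nat) (F : nat -> V) (m : nat) : (m < n)%N ->
  (forall j, (j < n)%N -> (m.+1 < j)%N || (j.+1 < m)%N -> F j = 0) ->
  \sum_(j < n) F j = (if m is p.+1 then F p else 0) + F m +
                     (if (m.+1 < n)%N then F m.+1 else 0).
Proof.
move=> mn F0.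
rewrite -(big_mkord xpredT) (@big_cat_nat _ _ _ m.+1) //=; congr (_ + _).
  case: m mn F0 => [|p] mn F0; first by rewrite big_nat1 add0r.
  rewrite !big_nat_recr //= big1_seq ?add0r // => j.
  by rewrite mem_index_iota => /andP[_ h]; apply: F0; lia.
case: ltnP => h; last by rewrite big_geq.
rewrite big_ltn // big1_seq ?addr0 // => j.
by rewrite mem_index_iota => /andP[_ hj]; apply: F0; lia.
Qed.

Section TridiagonalMatrix.
Variables (R : realType) (d : nat) (k : R).
Let c : R := (k + 2) / 4.

(** The diagonal is the one that makes the vector (1, k, ..., k) of degrees a
    right eigenvector for the eigenvalue k. *)
Definition tri_entry (j m : nat) : R :=
  if m == j.+1 then (if j == 0%N then 1 else c)
  else if j == m.+1 then (if m == 0%N then k else c)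
  else if j == m then
    (if j == 0%N then 0
     else k - (if j == 1%N then 1 else c) - (if (j < d)%N then c else 0))
  else 0.

Definition tri_mx : 'M[R]_d.+1 := \matrix_(j, m) tri_entry j m.

(** The symmetric solution of the three-term recurrence around d + 1/2: this
    symmetry is what the last row of the matrix asks for. *)
Definition wave (t : R) (j : nat) : R := cos ((d%:R + 2^-1 - j%:R) * t).

Lemma waveSS t j : wave t j.+2 = 2 * cos t * wave t j.+1 - wave t j.
Proof.
rewrite /wave; set y := (_ - j.+1%:R) * t.
have -> : (d%:R + 2^-1 - j.+2%:R) * t = y + (- t) by rewrite /y; ring.
have -> : (d%:R + 2^-1 - j%:R) * t = y + t by rewrite /y; ring.
by rewrite !cosD cosN sinN; ring.
Qed.

Lemma wave_last t : wave t d = cos (t / 2).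
Proof. by rewrite /wave; congr cos; field. Qed.

Lemma wave_reflect t : wave t d.+1 = wave t d.
Proof. by rewrite wave_last /wave -cosN; congr cos; field. Qed.

(** The entry of index 0 is dictated by the equation in column 1, where the
    matrix departs from the Toeplitz pattern. *)
Definition tri_eigenvector (t : R) (j : nat) : R :=
  if j == 0%N then c * wave t 0 + (1 - c) * wave t 1 else wave t j.

Lemma tri_eigenvector_defect t :
  tri_eigenvector t 1 * k - lambda_of k t * tri_eigenvector t 0 =
  (k + 2) / 2 * cos (t / 2) * (sin (t / 2) * theta_core d k t).
Proof.
have w0 : wave t 0 = cos (d%:R * t) * cos (t / 2) - sin (d%:R * t) * sin (t / 2).
  by rewrite /wave -cosD; congr cos; field.
have w1 : wave t 1 = cos (d%:R * t) * cos (t / 2) + sin (d%:R * t) * sin (t / 2).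
  rewrite /wave; have -> : (d%:R + 2^-1 - 1) * t = d%:R * t + (- (t / 2)) by field.
  by rewrite cosD cosN sinN; ring.
rewrite /tri_eigenvector /= /lambda_of w0 w1 (cos_half t) /theta_core /c.
set S := sin (d%:R * t); set C := cos (d%:R * t).
have := cos2Dsin2 (t / 2); set s := sin (t / 2); set g := cos (t / 2) => gs.
have g2 : g ^+ 2 = 1 - s ^+ 2 by lra.
have -> : (k + 2) / 2 * g * (s * (k * S * g + 2 * C * s)) =
  (k + 2) / 2 * s * (k * S * g ^+ 2 + 2 * C * s * g) by ring.
by rewrite g2; field.
Qed.

Lemma tri_eigenvalue t : (2 <= d)%N -> 0 <= t < pi -> theta_equation d k t ->
  eigenvalue tri_mx (lambda_of k t).
Proof.
move=> d2 /andP[t0 tpi] Et; set v := tri_eigenvector t.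
have lamE : lambda_of k t = 2 * c * cos t + (k - 2 * c).
  by rewrite /lambda_of /c; field.
have v10 : v 1%N * k = lambda_of k t * v 0%N.
  apply/eqP; rewrite -subr_eq0 tri_eigenvector_defect.
  suff -> : sin (t / 2) * theta_core d k t = 0 by rewrite mulr0.
  move/theta_equation_factor/eqP: Et.
  rewrite mulf_eq0 => /orP[/eqP s0|/eqP //].
  suff -> : t = 0 by rewrite !mul0r sin0 mul0r.
  apply/eqP; rewrite eq_le t0 leNgt andbT; apply/negP => tp.
  by have := sin_gt0_pi (x := t); rewrite tp tpi s0 ltxx => /(_ isT).
apply/eigenvalueP; exists (\row_(j < d.+1) v j).
  apply/rowP => m; rewrite !mxE.
  pose F (j : nat) := v j * tri_entry j m.
  rewrite (eq_bigr (fun j : 'I_d.+1 => F j)); last by move=> j _; rewrite !mxE.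
  rewrite (sum_band (m := m)) //; last first.
    move=> j jn jm; rewrite /F /tri_entry.
    have /negbTE-> : m != j.+1 :> nat by lia.
    have /negbTE-> : j != m.+1 :> nat by lia.
    have /negbTE-> : j != m :> nat by lia.
    by rewrite mulr0.
  rewrite {}/F; case: m => m /= mn.
  case: m mn => [|[|m]] mn.
  - by rewrite /tri_entry /= ltnS (ltnW d2) mulr0 !add0r v10.
  - by rewrite /tri_entry /v /tri_eigenvector /= ltnS d2 waveSS lamE; ring.
  - rewrite /tri_entry /v /tri_eigenvector /= !eqSS eqxx.
    have /negbTE-> : m != m.+1 by lia.
    have /negbTE-> : m != m.+2 by lia.
    rewrite !ltnS; case: ltnP => h; first by rewrite (waveSS t m.+1) lamE; ring.
    have dE : d = m.+2 by lia.
    have e : wave t m.+1 = (2 * cos t - 1) * wave t m.+2.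
      by have := waveSS t m.+1; rewrite -dE wave_reflect dE; lra.
    by rewrite lamE e; ring.
apply/eqP => /rowP/(_ ord_max); rewrite !mxE /v /tri_eigenvector /=.
have /negbTE-> : d != 0%N by lia.
rewrite wave_last; apply/eqP; rewrite gt_eqF // cos_gt0_pihalf //.
by have := pi_gt0 R; lra.
Qed.

Lemma lambda_of_inj t t' : 0 < k -> 0 <= t < pi -> 0 <= t' < pi ->
  lambda_of k t = lambda_of k t' -> t = t'.
Proof.
move=> k0 /andP[a b] /andP[a' b'] e.
apply: cos_inj; rewrite ?in_itv /= ?a ?a' ?(ltW b) ?(ltW b') //.
by move: e; rewrite /lambda_of => e; nra.
Qed.

End TridiagonalMatrix.

(** * Structure constants of real and P-polynomial table algebras *)

Section StructureConstants.
Variables (R : realType) (d : nat) (T : tableAlgebra R d).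
Local Notation x := (ta_elt T).
Local Notation beta := (ta_beta T).
Local Notation co := (coord (ta_basis T)).

Lemma elt0 : x ord0 = 1.
Proof. exact: ta_basis0. Qed.

Lemma elt_expand (u : ta_alg T) : u = \sum_m co m u *: x m.
Proof.
rewrite {1}(coord_basis (ta_basisP T) (memvf u)).
by apply: eq_bigr => m _; rewrite /ta_elt (tnth_nth 0).
Qed.

Lemma coord_elt m j : co m (x j) = (m == j)%:R.
Proof.
by rewrite /ta_elt (tnth_nth 0) coord_free 1?eq_sym // (basis_free (ta_basisP T)).
Qed.

Lemma mul_eltE i j : x i * x j = \sum_m beta i j m *: x m.
Proof. exact: elt_expand. Qed.

Lemma betaC i j m : beta i j m = beta j i m.
Proof. by rewrite /ta_beta /structure_const ta_mulC. Qed.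

Lemma beta_assoc i j m n :
  \sum_l beta i j l * beta l m n = \sum_l beta j m l * beta i l n.
Proof.
transitivity (co n (x i * x j * x m)).
  rewrite mul_eltE mulr_suml linear_sum; apply: eq_bigr => l _.
  by rewrite -scalerAl linearZ.
rewrite -mulrA mul_eltE mulr_sumr linear_sum; apply: eq_bigr => l _.
by rewrite -scalerAr linearZ.
Qed.

Lemma beta0l j m : beta ord0 j m = (m == j)%:R.
Proof.
by rewrite /ta_beta /structure_const ta_basis0 mul1r; exact: coord_elt.
Qed.

Lemma degree_sum (f : {lrmorphism ta_alg T -> R[i]^o}) i j :
  \sum_m beta i j m * f (x m) = (f (x i) : R[i]) * f (x j).
Proof.
rewrite -[RHS](rmorphM f) mul_eltE raddf_sum; apply: eq_bigr => m _.
by rewrite [RHS]linearZ.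
Qed.

Section Real.
Hypothesis rT : real_ta T.

Lemma real_beta0 i j : beta i j ord0 = if i == j then beta i i ord0 else 0.
Proof.
case: eqP => [->//|/eqP ij]; apply/eqP/negP => /negP/ta_const0_neq0.
by rewrite rT => e; rewrite e eqxx in ij.
Qed.

Lemma beta_diag_gt0 i : 0 < beta i i ord0.
Proof. by have := ta_const0_gt0 T i; rewrite rT. Qed.

(** Both sides are the coefficient of 1 in x_i x_j x_m. *)
Lemma beta_sym i j m :
  beta i j m * beta m m ord0 = beta i m j * beta j j ord0.
Proof.
have pick (F : 'I_d.+1 -> R[i]) n :
    \sum_l F l * beta l n ord0 = F n * beta n n ord0.
  rewrite (bigD1 n) //= big1 ?addr0 // => l ln.
  by rewrite real_beta0 (negbTE ln) mulr0.
have := beta_assoc j i m ord0.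
rewrite pick (eq_bigr (fun l => beta i m l * beta l j ord0)); last first.
  by move=> l _; rewrite (betaC j l).
by rewrite pick (betaC j i).
Qed.

Hypothesis x1poly : forall i : 'I_d.+1, (2 <= i)%N ->
  exists nu : {poly R[i]}, size nu = i.+1 /\ x i = horner_alg (x (inord 1)) nu.

Lemma elt_poly (i : 'I_d.+1) :
  exists nu : {poly R[i]}, size nu = i.+1 /\ x i = horner_alg (x (inord 1)) nu.
Proof.
case: (leqP 2 i) => [/x1poly //|].
case: i => -[|[|//]] idP _.
  exists 1; rewrite size_poly1 rmorph1 -elt0; split=> //.
  by congr x; exact: val_inj.
exists 'X; rewrite size_polyX horner_algX; split=> //; congr x; apply: val_inj.
by rewrite /= inordK.
Qed.

(** A polynomial of degree n in x_1 lies in the span of x_0, ..., x_n: subtract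
    the multiple of nu_n that cancels the leading term and induct on n. *)
Lemma coord_poly n (nu : {poly R[i]}) (m : 'I_d.+1) :
  (size nu <= n.+1)%N -> (n < m)%N -> co m (horner_alg (x (inord 1)) nu) = 0.
Proof.
elim: n nu => [|n IH] nu snu nm.
  have -> : nu = (nu`_0)%:P by apply: size1_polyC.
  rewrite horner_algC -elt0 linearZ /= coord_elt.
  by rewrite -val_eqE /= gtn_eqF // mulr0.
have nd : (n.+1 < d.+1)%N by apply: leq_trans nm (ltnW (ltn_ord m)).
have [nu' [s' e']] := elt_poly (Ordinal nd).
pose q := nu`_n.+1 / nu'`_n.+1.
have l0 : nu'`_n.+1 != 0.
  have := lead_coef_eq0 nu'; rewrite lead_coefE s' /= => ->.
  by rewrite -size_poly_eq0 s'.
have -> : horner_alg (x (inord 1)) nu =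
    q *: x (Ordinal nd) + horner_alg (x (inord 1)) (nu - q *: nu').
  by rewrite e' linearB linearZ /= mulr_algl [RHS]addrC subrK.
rewrite linearD linearZ /= coord_elt.
rewrite -val_eqE /= gtn_eqF // mulr0 add0r; apply: IH; last exact: ltnW.
apply/leq_sizeP => j; rewrite leq_eqVlt => /orP[/eqP <-|nj].
  by rewrite coefB coefZ divfK ?subrr.
rewrite coefB coefZ.
by rewrite !nth_default ?mulr0 ?subr0 // ?s' //; exact: leq_trans snu nj.
Qed.

Lemma beta1_up (j m : 'I_d.+1) : (j.+1 < m)%N -> beta (inord 1) j m = 0.
Proof.
move=> jm; have [nu [s e]] := elt_poly j.
rewrite /ta_beta /structure_const -/(x _) -/(x _) e.
rewrite -[X in X * _]horner_algX -rmorphM.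
apply: coord_poly jm; rewrite -s; apply: leq_trans (size_polyMleq _ _) _.
by rewrite size_polyX.
Qed.

Lemma beta1_band (j m : 'I_d.+1) :
  (j.+1 < m)%N || (m.+1 < j)%N -> beta (inord 1) j m = 0.
Proof.
case/orP => [/beta1_up//|mj]; apply/eqP.
rewrite -(mulIr_eq0 _ (mulIf (lt0r_neq0 (beta_diag_gt0 m)))).
by rewrite beta_sym beta1_up // mul0r.
Qed.

End Real.
End StructureConstants.

(** * Rigidity of homogeneous monotonic P-polynomial table algebras *)

(** Natural-number indices make the shifts i - 1 and i + 1 of the three-term
    recurrence available; only indices at most d are meaningful. *)
Definition beta_nat (R : realType) (d : nat) (T : tableAlgebra R d)
  (i j m : nat) : R[i] := ta_beta T (inord i) (inord j) (inord m).

Section Rigidity.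
Variables (R : realType) (d : nat) (T : tableAlgebra R d).
Variable f : {lrmorphism ta_alg T -> R[i]^o}.
Hypotheses (d5 : (5 <= d)%N) (Pf : P_polynomial_ta f) (Hf : homogeneous_ta f)
  (mT : monotonic_ta T).
Local Notation B := (beta_nat T).
Local Notation k := (ta_b T 0).
Local Notation c := (ta_c T 2).

Lemma P_polynomial_real : real_ta T.
Proof. by case: Pf. Qed.
Local Notation rT := P_polynomial_real.

Lemma ord_inordK i : (i <= d)%N -> (inord i : 'I_d.+1) = i :> nat.
Proof. by move=> ?; rewrite inordK. Qed.

Lemma inord0 : (inord 0 : 'I_d.+1) = ord0.
Proof. by apply: val_inj; rewrite /= inordK. Qed.

Lemma inord_neq0 i : (1 <= i <= d)%N -> (inord i : 'I_d.+1) != ord0.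
Proof. by move=> /andP[i1 id]; rewrite -val_eqE /= ord_inordK // -lt0n. Qed.

Lemma sum_inord (G : 'I_d.+1 -> R[i]) :
  \sum_l G l = \sum_(l < d.+1) G (inord l).
Proof. by apply: eq_bigr => l _; rewrite inord_val. Qed.

Lemma B_ge0 i j m : 0 <= B i j m.
Proof. exact: ta_const_ge0. Qed.

Lemma B_band j m : (j <= d)%N -> (m <= d)%N -> (j.+1 < m)%N || (m.+1 < j)%N ->
  B 1 j m = 0.
Proof.
case: Pf => rT' _ pf jd md h.
by apply: (beta1_band rT' pf); rewrite !ord_inordK.
Qed.

Lemma B0l j m : (j <= d)%N -> (m <= d)%N -> B 0 j m = (m == j)%:R.
Proof.
by move=> jd md; rewrite /beta_nat inord0 beta0l -val_eqE /= !ord_inordK.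
Qed.

Lemma B_n0 j m : (j <= d)%N -> (m <= d)%N -> B j 0 m = (m == j)%:R.
Proof. by move=> jd md; rewrite /beta_nat betaC -B0l. Qed.

Lemma k_gt0 : 0 < k.
Proof. by rewrite /ta_b inord0; exact: (beta_diag_gt0 rT). Qed.

Lemma degree_elt i : (1 <= i <= d)%N -> f (ta_elt T (inord i)) = k.
Proof.
move=> id; case: Hf => d2 h; case: Pf => _ sf _.
have d1 : (1 <= 1 <= d)%N by lia.
by rewrite (h _ _ (inord_neq0 id) (inord_neq0 d1)) sf rT -inord0.
Qed.

Lemma B_ii0 i : (1 <= i <= d)%N -> B i i 0 = k.
Proof.
move=> id; rewrite -(degree_elt id); case: Pf => _ sf _.
by rewrite sf rT /beta_nat inord0.
Qed.

Lemma B_sym j m : (1 <= j <= d)%N -> (1 <= m <= d)%N -> B 1 j m = B 1 m j.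
Proof.
move=> jd md; have := beta_sym rT (inord 1) (inord j) (inord m).
rewrite -inord0 -!/(beta_nat T _ _ _) !B_ii0 //.
by apply: mulIf; exact: lt0r_neq0 k_gt0.
Qed.

(** By symmetry b_i = c_{i+1}, so the sequence c_2, ..., c_d, increasing by
    the first half of monotonicity, is decreasing by the second half. *)
Lemma B_super i : (1 <= i)%N -> (i < d)%N -> B 1 i i.+1 = c.
Proof.
case: mT => mc mb.
have cbE j : (1 <= j)%N -> (j < d)%N -> ta_b T j = ta_c T j.+1.
  by move=> j1 jd; apply: B_sym; lia.
rewrite -[B _ _ _]/(ta_c T i.+1); elim: i => // -[|i] IH _ id //.
rewrite -IH //; last exact: ltnW.
apply/eqP; rewrite eq_le mc // andbT.
by rewrite -!cbE // ?mb //; lia.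
Qed.

Lemma B_sub i : (1 <= i)%N -> (i < d)%N -> B 1 i.+1 i = c.
Proof. by move=> i1 id; rewrite B_sym ?B_super //; lia. Qed.

Lemma c_neq0 : c != 0.
Proof.
(* c_2 >= c_1 = 1 *)
case: mT => mc _; apply/lt0r_neq0/(lt_le_trans ltr01).
apply: (@le_trans _ _ (ta_c T 1)); last by apply: mc; lia.
by rewrite -[ta_c T 1]/(B 1 0 1) B_n0 ?eqxx ?lexx //; lia.
Qed.

Lemma sum_row j (G : nat -> R[i]) : (1 <= j <= d)%N ->
  \sum_(l < d.+1) B 1 j l * G l =
  B 1 j j.-1 * G j.-1 + B 1 j j * G j +
  (if (j < d)%N then B 1 j j.+1 * G j.+1 else 0).
Proof.
move=> jd; rewrite (sum_band (m := j) (F := fun l => B 1 j l * G l)); last first.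
- by move=> l ld h; rewrite B_band ?mul0r //; lia.
- by lia.
by case: j jd => // j; rewrite ltnS.
Qed.

(** The degree map applied to x_1 x_j. *)
Lemma row_degree j : (1 <= j <= d)%N ->
  B 1 j j.-1 * (if j == 1%N then 1 else k) + B 1 j j * k +
  (if (j < d)%N then c * k else 0) = k * k.
Proof.
move=> jd; have j1 : (1 <= 1 <= d)%N by lia.
have := degree_sum f (inord 1) (inord j); rewrite !degree_elt // sum_inord => <-.
rewrite (sum_row (fun l => f (ta_elt T (inord l)) : R[i])) // (degree_elt jd).
congr (_ + _); last by case: ltnP => // h; rewrite degree_elt ?B_super //; lia.
congr (_ + _); congr (_ * _).
case: j jd => // -[|j] jd /=; last by rewrite degree_elt //; lia.
by rewrite inord0 elt0 rmorph1.
Qed.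

Lemma B_diag1 : B 1 1 1 = k - 1 - c.
Proof.
have d1 : (1 < d)%N by lia.
have /row_degree : (1 <= 1 <= d)%N by lia.
rewrite d1 -[B 1 1 1.-1]/k mulr1 => h; apply: (mulIf (lt0r_neq0 k_gt0)).
by rewrite !mulrBl -h; ring.
Qed.

Lemma B_diag_interior i : (2 <= i)%N -> (i < d)%N -> B 1 i i = k - c - c.
Proof.
case: i => // -[//|i] _ id; have /row_degree : (1 <= i.+2 <= d)%N by lia.
rewrite id /= B_sub ?(ltnW id) // => h; apply: (mulIf (lt0r_neq0 k_gt0)).
by rewrite !mulrBl -h; ring.
Qed.

Lemma B_diag_last : B 1 d d = k - c.
Proof.
have /row_degree : (1 <= d <= d)%N by lia.
have /negbTE-> : d != 1%N by lia.
have -> : B 1 d d.-1 = c.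
  have := @B_sub d.-1; rewrite prednK; last by lia.
  by apply; lia.
rewrite ltnn addr0 => h; apply: (mulIf (lt0r_neq0 k_gt0)).
by rewrite !mulrBl -h; ring.
Qed.

Lemma B_assoc i j m n :
  \sum_(l < d.+1) B i j l * B l m n = \sum_(l < d.+1) B j m l * B i l n.
Proof.
pose G l := ta_beta T (inord i) (inord j) l * ta_beta T l (inord m) (inord n).
by rewrite -(sum_inord G) beta_assoc sum_inord.
Qed.

(** (x_1 x_1) x_j = x_1 (x_1 x_j), which determines the products x_2 x_j. *)
Lemma B2_rec j n : (1 <= j <= d)%N ->
  k * B 0 j n + (k - 1 - c) * B 1 j n + c * B 2 j n =
  B 1 j j.-1 * B 1 j.-1 n + B 1 j j * B 1 j n +
  (if (j < d)%N then B 1 j j.+1 * B 1 j.+1 n else 0).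
Proof.
move=> jd; rewrite -(sum_row (fun l => B 1 l n)) //.
have := B_assoc 1 1 j n; rewrite (sum_row (fun l => B l j n)); last by lia.
have -> : (1 < d)%N by lia.
by rewrite -[B 1 1 1.-1]/k B_diag1 B_super //; lia.
Qed.

(** Nonnegativity of beta_{222} and of beta_{333} bounds c from below and from
    above by the same number. *)
Lemma homogeneous_c : 4 * c = k + 2.
Proof.
have e21 : B 1 2 1 = c by apply: B_sub; lia.
have e22 : B 1 2 2 = k - c - c by apply: B_diag_interior; lia.
have e23 : B 1 2 3 = c by apply: B_super; lia.
have e12 : B 1 1 2 = c by apply: B_super; lia.
have e32 : B 1 3 2 = c by apply: B_sub; lia.
have e33 : B 1 3 3 = k - c - c by apply: B_diag_interior; lia.
have e34 : B 1 3 4 = c by apply: B_super; lia.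
have e43 : B 1 4 3 = c by apply: B_sub; lia.
have e44 : B 1 4 4 = k - c - c by apply: B_diag_interior; lia.
have e24 : B 1 2 4 = 0 by apply: B_band; lia.
have e42 : B 1 4 2 = 0 by apply: B_band; lia.
have z22 : B 0 2 2 = 1 by rewrite B0l //; lia.
have z32 : B 0 3 2 = 0 by rewrite B0l //; lia.
have z34 : B 0 3 4 = 0 by rewrite B0l //; lia.
have l2 : (2 < d)%N by lia.
have l3 : (3 < d)%N by lia.
have b222 : B 2 2 2 = 4 * c - 2 - k.
  apply: (mulfI c_neq0); have /(@B2_rec 2 2) : (1 <= 2 <= d)%N by lia.
  rewrite /= l2 e12 e21 e22 e23 e32 z22.
  by move=> /(canRL (addKr _)) ->; ring.
have b232 : B 2 3 2 = k + 1 - 3 * c.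
  apply: (mulfI c_neq0); have /(@B2_rec 3 2) : (1 <= 3 <= d)%N by lia.
  rewrite /= l3 e32 e22 e33 e42 z32.
  by move=> /(canRL (addKr _)) ->; ring.
have b234 : B 2 3 4 = k + 1 - 3 * c.
  apply: (mulfI c_neq0); have /(@B2_rec 3 4) : (1 <= 3 <= d)%N by lia.
  rewrite /= l3 e32 e24 e33 e34 e44 z34.
  by move=> /(canRL (addKr _)) ->; ring.
have b333 : B 3 3 3 = k + 2 - 4 * c.
  (* the coefficient of x_3 in (x_1 x_2) x_3 = x_1 (x_2 x_3) *)
  apply: (mulfI c_neq0); have := B_assoc 1 2 3 3.
  rewrite (sum_row (fun l => B l 3 3)) /=; last by lia.
  rewrite l2 e21 e22 e23.
  rewrite (eq_bigr (fun l : 'I_d.+1 => B 1 3 l * B 2 3 l)); last first.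
    move=> [l ld] _ /=; rewrite mulrC; congr (_ * _).
    case: l ld => [|l] ld; last by apply: B_sym; lia.
    by rewrite !B_band //; lia.
  rewrite (sum_row (fun l => B 2 3 l)) /=; last by lia.
  rewrite l3 e32 e33 e34 b232 b234 => h.
  have {h} -> : c * B 3 3 3 =
      c * (k + 1 - 3 * c) + (k - c - c) * B 2 3 3 + c * (k + 1 - 3 * c)
      - c * (k - c - c) - (k - c - c) * B 2 3 3.
    by rewrite -h; ring.
  by ring.
apply/eqP; rewrite eq_le; have := B_ge0 2 2 2; have := B_ge0 3 3 3.
rewrite b222 b333 subr_ge0 => ->; rewrite -addrA -opprD subr_ge0.
by rewrite [2 + _]addrC => ->.
Qed.

Lemma valencyE : k = (valency T)%:C.
Proof.
rewrite /valency; case: (ta_b T 0) k_gt0 => a b.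
by rewrite ltcE /= => /andP[/eqP -> _].
Qed.

Lemma valency_gt0 : 0 < valency T.
Proof. by have := k_gt0; rewrite valencyE ltcR. Qed.

Lemma c_valencyE : c = ((valency T + 2) / 4)%:C.
Proof.
have n4 : (4 : R[i]) != 0 by rewrite pnatr_eq0.
apply: (mulfI n4); rewrite homogeneous_c valencyE.
rewrite -!(rmorph_nat (real_complex R)) -rmorphM -rmorphD; congr (_%:C).
by field.
Qed.

Lemma B1_tri_entry j m : (j <= d)%N -> (m <= d)%N ->
  B 1 j m = (tri_entry d (valency T) j m)%:C.
Proof.
move=> jd md; rewrite /tri_entry.
have [h|h] := boolP ((j.+1 < m)%N || (m.+1 < j)%N).
  rewrite B_band //.
  have /negbTE-> : m != j.+1 by lia.
  have /negbTE-> : j != m.+1 by lia.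
  by have /negbTE-> : j != m by lia.
have [/eqP mj|mj] := boolP (m == j.+1).
  rewrite mj; case: j {jd h} mj => [|j] mj; first by rewrite B_n0 ?eqxx //; lia.
  by rewrite B_super ?c_valencyE //; lia.
have [/eqP jm|jm] := boolP (j == m.+1).
  rewrite jm; case: m {md h mj} jm => [|m] jm; first by rewrite -valencyE.
  by rewrite B_sub ?c_valencyE //; lia.
have -> : m = j by lia.
rewrite eqxx; case: j jd {h mj jm} => [|[|j]] jd.
- by rewrite B_n0 //; lia.
- have -> : (1 < d)%N by lia.
  by rewrite B_diag1 c_valencyE valencyE !rmorphB.
rewrite /=; case: ltnP => h.
  by rewrite B_diag_interior // c_valencyE valencyE !rmorphB.
have -> : j.+2 = d by lia.
by rewrite B_diag_last c_valencyE valencyE subr0 rmorphB.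
Qed.

Lemma first_intersection_matrixE :
  first_intersection_matrix T = map_mx (real_complex R) (tri_mx d (valency T)).
Proof.
apply/matrixP => j m; rewrite !mxE -[RHS]B1_tri_entry ?leq_ord //.
by rewrite /beta_nat !inord_val.
Qed.

End Rigidity.

(** * The eigenvalues *)

Theorem theorem5p2 (R : realType) (d : nat) (T : tableAlgebra R d)
    (f : {lrmorphism ta_alg T -> R[i]^o}) :
  (5 <= d)%N ->
  is_degree_map f ->
  P_polynomial_ta f ->
  homogeneous_ta f ->
  monotonic_ta T ->
  exists theta : 'I_d.+1 -> R,
    [/\ injective theta,
        forall t : R,
          (0 <= t < pi /\ theta_equation d (valency T) t) <->
          (exists i, t = theta i)
      & forall z : R[i],
          eigenvalue (first_intersection_matrix T) z <->
          (exists i, z = (lambda_of (valency T) (theta i))%:C)].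
Proof.
move=> d5 _ Pf Hf mT.
have d2 : (2 <= d)%N by lia.
have k0 := valency_gt0 Pf.
rewrite (first_intersection_matrixE d5 Pf Hf mT); set k := valency T.
set M := map_mx _ _.
have [theta [theta_inj theta_root]] := theta_roots d k0; exists theta.
have eig (t : R) : 0 <= t < pi -> theta_equation d k t ->
    eigenvalue M (lambda_of k t)%:C.
  by move=> t0 te; rewrite eigenvalue_map; exact: tri_eigenvalue.
pose lam (i : 'I_d.+1) : R[i] := (lambda_of k (theta i))%:C.
have lam_eig i : eigenvalue M (lam i) by have [a b] := theta_root i; exact: eig.
have lam_inj : injective lam.
  move=> i j [] e; apply: theta_inj.
  have [ti _] := theta_root i; have [tj _] := theta_root j.
  exact: lambda_of_inj k0 ti tj e.
have eig_lam z : eigenvalue M z -> exists i, z = lam i.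
  (* one more eigenvalue would give the characteristic polynomial d+2 roots *)
  move=> ez; have [/codomP //|nz] := boolP (z \in codom lam).
  have := @max_poly_roots _ (char_poly M) (z :: codom lam).
  rewrite -size_poly_eq0 size_char_poly /= size_codom card_ord ltnn nz.
  rewrite map_inj_uniq ?enum_uniq // -eigenvalue_root_char ez /=.
  have -> : all (root (char_poly M)) (codom lam).
    apply/allP => _ /codomP[i ->]; rewrite -eigenvalue_root_char.
    exact: lam_eig.
  by move=> /(_ isT isT isT).
split=> // [t|z]; split.
- case=> t0 te; have [i [] e] := eig_lam _ (eig t t0 te); exists i.
  by have [ti _] := theta_root i; exact: lambda_of_inj k0 t0 ti e.
- by case=> i ->.
- exact: eig_lam.
- by case=> i ->; exact: lam_eig.
Qed.
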